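(* Let $m,n$ be positive integers and let $\mathcal{R}=(r_1,\ldots,r_m)$, $\mathcal{C}=(c_1,\ldots,c_n)$ be sequences of integers with $n=r_1\ge r_2\ge\cdots\ge r_m$ and $m=c_1\ge c_2\ge\cdots\ge c_n$, and assume that $(\mathcal{R},\mathcal{C})$ is consistent. Start from the uniquely determined neighbour $F_1$ and run the procedure described in the context (repeatedly applying A-steps or B-steps, each of which fixes and deletes one column, until the current $d_i$ are all $0$), and then put all deleted columns back in their original positions. Then this procedure can be carried out until it stops, and the resulting set $F_2$ has row sums $\mathcal{R}$ and column sums $\mathcal{C}$.
   Context: For a finite set $F\subseteq\mathbb{Z}^2$, row $i$ is $\{(i,l)\}$ and column $j$ is $\{(k,j)\}$ (matrix convention: first coordinate is the row index). The row sum $r_i$ is the number of points of $F$ in row $i$ and the column sum $c_j$ the number of points of $F$ in column $j$. The pair $(\mathcal{R},\mathcal{C})$ is consistent if there exists $F\subseteq\{1,\ldots,m\}\times\{1,\ldots,n\}$ with row sums $r_1,\ldots,r_m$ and column sums $c_1,\ldots,c_n$. The uniquely determined neighbour is $F_1=\{(i,j):1\le j\le n,\ 1\le i\le c_j\}$; its row sums are $b_i=\#\{j:c_j\ge i\}$. The procedure. A state consists of a set $J\subseteq\{1,\ldots,n\}$ of remaining columns (initially all $n$ columns, with their original column sums $c_j$) and current row sums $r_1,\ldots,r_m$ (initially the given ones). In the current state set $b_i=\#\{j\in J: c_j\ge i\}$, $d_i=b_i-r_i$ for $1\le i\le m$, and $r_{m+1}=b_{m+1}=d_{m+1}=0$.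 If $d_i=0$ for all $i$, the procedure stops. Otherwise let $i_1$ be minimal with $d_{i_1}>0$, $i_2$ minimal with $d_{i_2}>0$ and $d_{i_2+1}\le 0$, $R^+=\{i_1,\ldots,i_2\}$; let $i_3$ be minimal with $d_{i_3}<0$, $i_4$ minimal with $d_{i_4}<0$ and $d_{i_4+1}\ge 0$, $R^-=\{i_3,\ldots,i_4\}$. A-step (performed if $|R^+|\le|R^-|$): let $j$ be the largest element of $J$ with $c_j\in R^+$ and $s=c_j-i_1+1$. If $r_{i_3+s-1}>r_{i_3+s}$, let $I=\{i_3,\ldots,i_3+s-1\}$. Otherwise let $t_1$ be minimal with $i_3\le t_1\le i_3+s-1$ and $r_{t_1}=r_{i_3+s-1}$, let $t_2\ge i_3+s$ be such that $r_{t_2}=r_{i_3+s-1}>r_{t_2+1}$, let $t_3=t_2+t_1-i_3-s+1$, and let $I=\{i_3,\ldots,t_1-1\}\cup\{t_3,\ldots,t_2\}$. The final content of column $j$ is $\{(i,j):1\le i<i_1\}\cup\{(i,j): i\in I\}$ (i.e. the points of $F_1$ in rows $i_1,\ldots,c_j$ of column $j$ are moved to the rows in $I$). B-step (performed if $|R^+|>|R^-|$): let $j$ be the smallest element of $J$ with $c_j+1\in R^-$ and $s=i_4-c_j$. If $r_{i_2-s}>r_{i_2-s+1}$, let $I=\{i_2-s+1,\ldots,i_2\}$. Otherwise let $t_1$ be maximal with $i_2-s+1\le t_1\le i_2$ and $r_{t_1}=r_{i_2-s+1}$, let $t_2\le i_2-s$ be such that $r_{t_2-1}>r_{t_2}=r_{i_2-s+1}$,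 let $t_3=t_2+s-1-(i_2-t_1)$, and let $I=\{t_2,\ldots,t_3\}\cup\{t_1+1,\ldots,i_2\}$ (so $I\subseteq R^+$, $|I|=s$, and if $i\notin I$, $i+1\in I$ then $r_i>r_{i+1}$). The final content of column $j$ is $\{(i,j):1\le i\le c_j,\ i\notin I\}\cup\{(i,j):c_j+1\le i\le i_4\}$. After an A-step or B-step in column $j$, remove $j$ from $J$ and decrease $r_i$ by $1$ for every row $i$ containing a point of the final column $j$; then continue with the new state. When the procedure stops, each column $j$ still in $J$ is given final content $\{(i,j):1\le i\le c_j\}$. The set $F_2$ is the union of the final contents of all columns $1,\ldots,n$. *)

(* Defs.v *)
From Stdlib Require Export Relations.
From mathcomp Require Export all_boot all_order all_algebra finmap.

Set Implicit Arguments.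
Unset Strict Implicit.
Unset Printing Implicit Defensive.

Import Order.TTheory GRing.Theory Num.Theory.

Local Open Scope fset_scope.
Local Open Scope ring_scope.

(* Points of Z^2 are pairs (row, column).  Rows, columns and their sums are all
   integers, with rows and columns numbered from 1, so that a column sum can be
   used as a row index and no subtraction is truncated.  A sequence
   (x_1, ..., x_k) is a function x : int -> int of which only the values at
   1, ..., k are ever used. *)

(* The integer interval {a, ..., b}, empty when b < a. *)
Definition zint (a b : int) : {fset int} :=
  [fset a + k%:Z | k in iota 0 (if a <= b then `|b - a|%N.+1 else 0%N)].

Lemma in_zint (a b x : int) : (x \in zint a b) = (a <= x <= b).
Proof.
apply/imfsetP/idP => [[k /=]|/andP[ax xb]].
  case: ifP => // ab; rewrite mem_iota add0n ltnS /= => kab ->.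
  rewrite lerDl lez_nat leq0n /= -lerBrDl.
  by move: kab; rewrite -lez_nat gez0_abs ?subr_ge0.
exists `|x - a|%N; last by rewrite gez0_abs ?subr_ge0 // addrCA subrr addr0.
rewrite /= (le_trans ax xb) mem_iota add0n ltnS /= -lez_nat.
by rewrite !gez0_abs ?subr_ge0 ?lerB ?(le_trans ax xb).
Qed.

Definition row_sum (F : {fset int * int}) (i : int) : int :=
  #|` [fset p in F | p.1 == i]|%:Z.

Definition col_sum (F : {fset int * int}) (j : int) : int :=
  #|` [fset p in F | p.2 == j]|%:Z.

Definition has_sums (m n : nat) (R C : int -> int) (F : {fset int * int}) : Prop :=
  [/\ forall p, p \in F -> 1 <= p.1 <= m%:Z /\ 1 <= p.2 <= n%:Z,
      forall i, 1 <= i <= m%:Z -> row_sum F i = R i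
    & forall j, 1 <= j <= n%:Z -> col_sum F j = C j].

Definition consistent (m n : nat) (R C : int -> int) : Prop :=
  exists F : {fset int * int}, has_sums m n R C F.

Definition column (j : int) (K : {fset int}) : {fset int * int} :=
  [fset (i, j) | i in K].

(* The part of the uniquely determined neighbour F_1 in the columns of J; for
   J = {1, ..., n} it is F_1 itself. *)
Definition neighbour (C : int -> int) (J : {fset int}) : {fset int * int} :=
  \bigcup_(j <- J) column j (zint 1 (C j)).

Definition is_min (P : int -> Prop) (x : int) : Prop :=
  P x /\ forall y, P y -> x <= y.

Definition is_max (P : int -> Prop) (x : int) : Prop :=
  P x /\ forall y, P y -> y <= x.

(* [done_part] is the union of the final contents of the columns already
   deleted from [remaining]. *)
Record state := State {
  remaining : {fset int};
  current : int -> int;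
  done_part : {fset int * int} }.

Definition init (n : nat) (R : int -> int) : state := State (zint 1 n%:Z) R fset0.

(* [rsum] and [diff] are r_i and d_i for 1 <= i <= m + 1, with the convention
   r_{m+1} = d_{m+1} = 0. *)
Definition rsum (m : nat) (st : state) (i : int) : int :=
  if 1 <= i <= m%:Z then current st i else 0.

Definition bsum (C : int -> int) (st : state) (i : int) : int :=
  #|` [fset j in remaining st | i <= C j]|%:Z.

Definition diff (m : nat) (C : int -> int) (st : state) (i : int) : int :=
  if 1 <= i <= m%:Z then bsum C st i - rsum m st i else 0.

Definition stopped (m : nat) (C : int -> int) (st : state) : Prop :=
  forall i, 1 <= i <= m%:Z -> diff m C st i = 0.

(* R^+ = {i1, ..., i2} and R^- = {i3, ..., i4}. *)
Definition extremes (m : nat) (C : int -> int) (st : state)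
    (i1 i2 i3 i4 : int) : Prop :=
  let d := diff m C st in
  [/\ is_min (fun i => 1 <= i <= m%:Z /\ 0 < d i) i1,
      is_min (fun i => [/\ 1 <= i <= m%:Z, 0 < d i & d (i + 1) <= 0]) i2,
      is_min (fun i => 1 <= i <= m%:Z /\ d i < 0) i3
    & is_min (fun i => [/\ 1 <= i <= m%:Z, d i < 0 & 0 <= d (i + 1)]) i4].

Definition fix_column (st : state) (j : int) (K : {fset int}) : state :=
  State (remaining st `\ j)
        (fun i => if i \in K then current st i - 1 else current st i)
        (done_part st `|` column j K).

Definition A_rows (m : nat) (r : int -> int) (i3 s : int) (I : {fset int}) : Prop :=
  if r (i3 + s) < r (i3 + s - 1) then I = zint i3 (i3 + s - 1)
  else exists t1 t2 t3 : int,
    [/\ is_min (fun t => i3 <= t <= i3 + s - 1 /\ r t = r (i3 + s - 1)) t1,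
        [/\ i3 + s <= t2 <= m%:Z, r t2 = r (i3 + s - 1)
          & r (t2 + 1) < r (i3 + s - 1)],
        t3 = t2 + t1 - i3 - s + 1
      & I = zint i3 (t1 - 1) `|` zint t3 t2].

Definition A_step (m : nat) (C : int -> int) (st st' : state) : Prop :=
  exists i1 i2 i3 i4 j s : int, exists I : {fset int},
    extremes m C st i1 i2 i3 i4 /\
    [/\ (#|` zint i1 i2| <= #|` zint i3 i4|)%N,
        is_max (fun k => k \in remaining st /\ C k \in zint i1 i2) j,
        s = C j - i1 + 1,
        A_rows m (rsum m st) i3 s I
      & st' = fix_column st j (zint 1 (i1 - 1) `|` I)].

(* r_{t2-1} only exists for t2 >= 2. *)
Definition B_rows (r : int -> int) (i2 s : int) (I : {fset int}) : Prop :=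
  if r (i2 - s + 1) < r (i2 - s) then I = zint (i2 - s + 1) i2
  else exists t1 t2 t3 : int,
    [/\ is_max (fun t => i2 - s + 1 <= t <= i2 /\ r t = r (i2 - s + 1)) t1,
        [/\ 2 <= t2 <= i2 - s, r t2 = r (i2 - s + 1) & r t2 < r (t2 - 1)],
        t3 = t2 + s - 1 - (i2 - t1)
      & I = zint t2 t3 `|` zint (t1 + 1) i2].

Definition B_step (m : nat) (C : int -> int) (st st' : state) : Prop :=
  exists i1 i2 i3 i4 j s : int, exists I : {fset int},
    extremes m C st i1 i2 i3 i4 /\
    [/\ (#|` zint i3 i4| < #|` zint i1 i2|)%N,
        is_min (fun k => k \in remaining st /\ C k + 1 \in zint i3 i4) j,
        s = i4 - C j,
        B_rows (rsum m st) i2 s I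
      & st' = fix_column st j ((zint 1 (C j) `\` I) `|` zint (C j + 1) i4)].

Definition step (m : nat) (C : int -> int) (st st' : state) : Prop :=
  ~ stopped m C st /\ (A_step m C st st' \/ B_step m C st st').

Definition reachable (m n : nat) (R C : int -> int) (st : state) : Prop :=
  clos_refl_trans state (step m C) (init n R) st.

(* Meaningful when [st] is stopped: the columns that were never treated keep
   their content in F_1. *)
Definition F2 (C : int -> int) (st : state) : {fset int * int} :=
  done_part st `|` neighbour C (remaining st).

(* Main.v *)
Require Import Defs.
From mathcomp Require Import all_boot all_order all_algebra finmap zify.

(* For a current state let D k = d_1 + ... + d_k.  The Gale-Ryser condition
   "D >= 0 and D m = 0", the monotonicity of the current row sums and d_1 = 0
   are preserved by every step.  Indeed both kinds of step replace, in a column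
   of height c, the rows of a set S included in R^+ and in {1, ..., c} by those
   of a set T included in R^- and lying above c, with |S| = |T|; this lowers d
   by 1 on S and raises it by 1 on T, so d keeps its sign on R^+ and on R^-.
   Hence D still increases from 0 before R^-, and decreases on R^- to its old,
   nonnegative, value at i_4.  The row sums remain monotone because they drop
   strictly after every row of the new column that is followed by a row outside
   it: this is what the choice of I ensures inside R^+ and R^-, and it is
   automatic at i_1 - 1 and at i_4.  As long as d is not 0, these invariants
   also provide everything that the next step needs, and each step deletes a
   column. *)

Set Implicit Arguments.
Unset Strict Implicit.
Unset Printing Implicit Defensive.

Import Order.TTheory GRing.Theory Num.Theory.

Local Open Scope fset_scope.
Local Open Scope ring_scope.

(** * Cardinalities of intervals and of filtered finite sets *)

Lemma card_zint (a b : int) :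
  #|` zint a b|%:Z = if a <= b then b - a + 1 else 0.
Proof.
rewrite /zint card_imfset /=; last by move=> x y /addrI[].
rewrite undup_id ?iota_uniq // size_iota; case: ifP => ? //; lia.
Qed.

Lemma card_filter (T : choiceType) (A : {fset T}) (P : pred T) :
  #|` [fset x in A | P x]| = (\sum_(x <- A) P x)%N.
Proof. by rewrite card_fset_sum1 big_fset /= -big_mkcond. Qed.

Lemma card_filterD (T : choiceType) (A : {fset T}) (P P1 P2 : pred T) :
  {in A, forall x, (P x : nat) = (P1 x + P2 x)%N} ->
  #|` [fset x in A | P x]| =
    (#|` [fset x in A | P1 x]| + #|` [fset x in A | P2 x]|)%N.
Proof.
move=> PE; rewrite !card_filter -big_split /= big_seq [RHS]big_seq.
exact: eq_bigr.
Qed.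

Lemma filter_fset_all (T : choiceType) (A : {fset T}) (P : pred T) :
  {in A, forall x, P x} -> [fset x in A | P x] = A.
Proof.
by move=> AP; apply/fsetP => x; rewrite !inE /=; case: (boolP (x \in A)) => // /AP.
Qed.

Lemma filter_fset_none (T : choiceType) (A : {fset T}) (P : pred T) :
  {in A, forall x, ~~ P x} -> [fset x in A | P x] = fset0.
Proof.
move=> AP; apply/fsetP => x; rewrite !inE /=.
by case: (boolP (x \in A)) => // /AP/negbTE.
Qed.

Lemma card_filterU (T : choiceType) (A B : {fset T}) (P : pred T) :
  [disjoint A & B] ->
  #|` [fset x in A `|` B | P x]| =
    (#|` [fset x in A | P x]| + #|` [fset x in B | P x]|)%N.
Proof.
move=> /fdisjointP AB.
rewrite -(cardfsUI [fset x in A | P x]) [X in (_ + X)%N](_ : _ = 0%N).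
  rewrite addn0; congr #|` _|; apply/fsetP => x.
  by rewrite !inE /= andb_orl.
apply/eqP; rewrite cardfs_eq0; apply/eqP/fsetP => x; rewrite !inE /=.
by case: (boolP (x \in A)) => // /AB/negbTE ->; rewrite andbF.
Qed.

(** * Row and column sums of disjoint unions, of single columns and of $F_1$ *)

Lemma row_sumU (F G : {fset int * int}) (i : int) :
  [disjoint F & G] -> row_sum (F `|` G) i = row_sum F i + row_sum G i.
Proof. by move=> FG; rewrite /row_sum card_filterU. Qed.

Lemma col_sumU (F G : {fset int * int}) (j : int) :
  [disjoint F & G] -> col_sum (F `|` G) j = col_sum F j + col_sum G j.
Proof. by move=> FG; rewrite /col_sum card_filterU. Qed.

Lemma in_column (j : int) (K : {fset int}) (p : int * int) :
  (p \in column j K) = (p.1 \in K) && (p.2 == j).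
Proof.
apply/imfsetP/andP => [[i iK ->]|[pK /eqP pj]] //.
by exists p.1 => //; rewrite -pj -surjective_pairing.
Qed.

Lemma card_column (j : int) (K : {fset int}) : #|` column j K| = #|` K|.
Proof. by rewrite card_imfset // => x y []. Qed.

Lemma row_sum_column (j i : int) (K : {fset int}) :
  row_sum (column j K) i = (i \in K)%:Z.
Proof.
rewrite /row_sum.
have -> : [fset p in column j K | p.1 == i] =
    [fset p in [fset (i, j)] | i \in K].
  apply/fsetP => -[a b]; rewrite !inE /= in_column /= xpair_eqE.
  by case: (eqVneq a i) => [->|]; rewrite ?andbT ?andbF //= andbC.
by rewrite card_filter big_seq_fset1.
Qed.

Lemma col_sum_column (j k : int) (K : {fset int}) :
  col_sum (column j K) k = if k == j then #|` K|%:Z else 0.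
Proof.
rewrite /col_sum; case: eqP => [->|kj].
  rewrite filter_fset_all => [|p]; last by rewrite in_column => /andP[].
  by rewrite card_column.
rewrite filter_fset_none // => p; rewrite in_column => /andP[_ /eqP ->].
by apply/eqP => /esym.
Qed.

Lemma in_neighbour (C : int -> int) (J : {fset int}) (p : int * int) :
  (p \in neighbour C J) = (p.2 \in J) && (1 <= p.1 <= C p.2).
Proof.
rewrite /neighbour; apply/bigfcupP/andP => [[j]|[pJ pC]].
  by rewrite andbT in_column in_zint => jJ /andP[pC /eqP ->].
by exists p.2; rewrite ?andbT // in_column in_zint pC eqxx.
Qed.

Lemma row_sum_neighbour (C : int -> int) (J : {fset int}) (i : int) :
  1 <= i -> row_sum (neighbour C J) i = #|` [fset j in J | i <= C j]|%:Z.
Proof.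
move=> i_gt0; rewrite /row_sum.
have -> : [fset p in neighbour C J | p.1 == i] =
    [fset (i, j) | j in [fset j in J | i <= C j]].
  apply/fsetP => -[a b]; rewrite !inE /= in_neighbour /=.
  apply/idP/imfsetP => [/andP[/andP[bJ /andP[_ aC]] /eqP ai]|[j /=]].
    by exists b; rewrite ?ai // !inE bJ -ai.
  by rewrite !inE => /andP[jJ iC] [-> ->]; rewrite jJ i_gt0 iC eqxx.
by rewrite card_imfset // => x y [].
Qed.

(** The minimum is also the most that a set with rows numbered from 1 and column sum [C j] can have
    in the first [k] rows of column [j]; this extremal property of $F_1$ yields the Gale-Ryser
    condition for the initial state. *)
Lemma card_col_neighbour (C : int -> int) (J : {fset int}) (k j : int) :
  j \in J ->
  #|` [fset p in [fset p in neighbour C J | p.1 <= k] | p.2 == j]| =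
  #|` zint 1 (Num.min (C j) k)|.
Proof.
move=> jJ.
have -> : [fset p in [fset p in neighbour C J | p.1 <= k] | p.2 == j] =
    column j (zint 1 (Num.min (C j) k)).
  apply/fsetP => -[a b]; rewrite !inE /= in_neighbour in_column in_zint /=.
  case: eqP => [->|]; rewrite ?andbF // jJ /=; lia.
by rewrite card_column.
Qed.

Lemma col_sum_neighbour (C : int -> int) (J : {fset int}) (j : int) :
  col_sum (neighbour C J) j = if j \in J then #|` zint 1 (C j)|%:Z else 0.
Proof.
rewrite /col_sum; case: ifP => jJ; last first.
  rewrite filter_fset_none // => p; rewrite in_neighbour => /andP[pJ _].
  by apply/eqP => pj; rewrite -pj pJ in jJ.
have := card_col_neighbour C (C j) jJ; rewrite minxx => <-.
congr (#|` _|%:Z); apply/fsetP => -[a b]; rewrite !inE in_neighbour /=.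
by case: eqP => [->|]; rewrite ?andbF // jJ; lia.
Qed.

(** Double counting: after exchanging the sums, each point of [F] is counted once, in its own
    column. It allows $F$ and $F_1$ to be compared column by column. *)
Lemma card_by_column (F : {fset int * int}) (J : {fset int}) :
  {in F, forall p, p.2 \in J} ->
  #|` F| = (\sum_(j <- J) #|` [fset p in F | p.2 == j]|)%N.
Proof.
move=> FJ; under eq_bigr do rewrite card_filter.
rewrite exchange_big /= card_fset_sum1 big_seq [RHS]big_seq.
apply: eq_bigr => p /FJ pJ; rewrite (big_fsetD1 p.2) //= eqxx big1_fset //.
by move=> j; rewrite !inE => /andP[/negbTE jp _] _; rewrite eq_sym jp.
Qed.

(** * Induction, partial sums and extrema over the integers *)

Lemma int_ind_up (P : int -> Prop) (a b : int) :
  P a -> (forall i : int, a <= i < b -> P i -> P (i + 1)) ->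
  forall i : int, a <= i <= b -> P i.
Proof.
move=> Pa PS i /andP[ai ib].
have [k ik] : exists k : nat, i = a + k%:Z by exists `|i - a|%N; lia.
elim: k i ik ai ib => [|k IH] i ik ai ib; first by rewrite ik addr0.
have -> : i = a + k%:Z + 1 by lia.
by apply: PS; [lia | apply: IH; lia].
Qed.

(** Partial sums are given by their recurrence, so the same statement serves for D where d is
    nonnegative and, after negation, where d is nonpositive. *)
Lemma le_psum (f g : int -> int) (a b : int) :
  (forall i : int, a < i <= b -> f i = f (i - 1) + g i) ->
  (forall i : int, a < i <= b -> 0 <= g i) ->
  forall i : int, a <= i <= b -> f a <= f i.
Proof.
move=> fE g_ge0; apply: int_ind_up => // i iab fi.
have iab' : a < i + 1 <= b by lia.
have := g_ge0 _ iab'; have := fE _ iab'; rewrite addrK; lia.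
Qed.

(** Translation by [a] reduces this to [nat]; the boolean [p] supplies the decidability that
    [ex_minnP] asks for. *)
Lemma is_min_exists (p : pred int) (P : int -> Prop) (a : int) :
  (forall x, reflect (P x) (p x)) -> (forall x, P x -> a <= x) ->
  (exists x, P x) -> exists x, is_min P x.
Proof.
move=> pP Pa [x Px].
have [|k /pP Pk kmin] := @ex_minnP (fun k => p (a + k%:Z)).
  by exists `|x - a|%N; rewrite gez0_abs ?subr_ge0 ?Pa // subrKC; apply/pP.
exists (a + k%:Z); split=> // y Py; have ay := Pa _ Py.
have := kmin `|y - a|%N; rewrite gez0_abs ?subr_ge0 // subrKC.
by move=> /(_ (introT (pP y) Py)); lia.
Qed.

Lemma is_max_exists (p : pred int) (P : int -> Prop) (b : int) :
  (forall x, reflect (P x) (p x)) -> (forall x, P x -> x <= b) ->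
  (exists x, P x) -> exists x, is_max P x.
Proof.
move=> pP Pb [x Px].
have [|||y [Py ymin]] :=
  @is_min_exists (fun y => p (- y)) (fun y => P (- y)) (- b).
- by move=> y; apply: pP.
- by move=> y /Pb; lia.
- by exists (- x); rewrite opprK.
exists (- y); split=> // z Pz; have := ymin (- z); rewrite opprK => /(_ Pz).
lia.
Qed.

(** * The Gale-Ryser condition and the sign pattern of d *)

(* D k = d_1 + ... + d_k.  For d = b - r this is the Gale-Ryser condition. *)
Definition dominates (m : nat) (d : int -> int) : Prop :=
  exists D : int -> int,
    [/\ D 0 = 0, D m%:Z = 0,
        forall i : int, 1 <= i <= m%:Z -> D i = D (i - 1) + d i
      & forall i : int, 0 <= i <= m%:Z -> 0 <= D i].

(** Otherwise D never increases; starting from 0 and staying nonnegative, it vanishes, and so does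
    d. *)
Lemma dominates_pos (m : nat) (d : int -> int) (i0 : int) :
  dominates m d -> 1 <= i0 <= m%:Z -> d i0 != 0 ->
  exists2 i, 1 <= i <= m%:Z & 0 < d i.
Proof.
move=> [D [D0 Dm DS D_ge0]] i0m di0.
case: (boolP (all (fun i => d i <= 0) (zint 1 m%:Z))) => [/allP d_le0|].
  have D_le0 i : 0 <= i <= m%:Z -> D i <= 0.
    move=> im; have /= := @le_psum (fun i => - D i) (fun i => - d i) 0 m%:Z.
    rewrite D0 => /(_ _ _ i im); rewrite oppr0 oppr_ge0; apply.
      move=> k km /=; by rewrite (DS k) ?opprD //; lia.
    by move=> k km /=; rewrite oppr_ge0 d_le0 // in_zint; lia.
  have := D_le0 i0; have := D_le0 (i0 - 1); have := DS i0.
  by have := D_ge0 i0; have := D_ge0 (i0 - 1); lia.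
by case/allPn => i; rewrite in_zint -ltNge; exists i.
Qed.

(** Otherwise D never decreases; ending at [D m = 0] and staying nonnegative, it vanishes, and so
    does d. *)
Lemma dominates_neg (m : nat) (d : int -> int) (i0 : int) :
  dominates m d -> 1 <= i0 <= m%:Z -> d i0 != 0 ->
  exists2 i, 1 <= i <= m%:Z & d i < 0.
Proof.
move=> [D [D0 Dm DS D_ge0]] i0m di0.
case: (boolP (all (fun i => 0 <= d i) (zint 1 m%:Z))) => [/allP d_ge0|].
  have D_le0 i : 0 <= i <= m%:Z -> D i <= 0.
    move=> im; rewrite -Dm; apply: (@le_psum D d i m%:Z); last by lia.
      by move=> k km; apply: DS; lia.
    by move=> k km; rewrite d_ge0 // in_zint; lia.
  have := D_le0 i0; have := D_le0 (i0 - 1); have := DS i0.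
  by have := D_ge0 i0; have := D_ge0 (i0 - 1); lia.
by case/allPn => i; rewrite in_zint -ltNge; exists i.
Qed.

Lemma diff_out (m : nat) (C : int -> int) (st : state) (i : int) :
  m%:Z < i -> diff m C st i = 0.
Proof. by rewrite /diff => im; case: ifP => //; lia. Qed.

Lemma stoppedP (m : nat) (C : int -> int) (st : state) :
  stopped m C st \/ exists2 i, 1 <= i <= m%:Z & diff m C st i != 0.
Proof.
case: (boolP (all (fun i => diff m C st i == 0) (zint 1 m%:Z))).
  by move=> /allP d0; left=> i im; apply/eqP/d0; rewrite in_zint.
by case/allPn => i; rewrite in_zint => im di; right; exists i.
Qed.

Lemma extremes_exist (m : nat) (C : int -> int) (st : state) (i0 : int) :
  dominates m (diff m C st) -> 1 <= i0 <= m%:Z -> diff m C st i0 != 0 ->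
  exists i1 i2 i3 i4, extremes m C st i1 i2 i3 i4.
Proof.
move=> dom i0m di0; set d := diff m C st in dom di0.
have [p pm dp] := dominates_pos dom i0m di0.
have [q qm dq] := dominates_neg dom i0m di0.
have [|||i1 i1P] := @is_min_exists (fun i => (1 <= i <= m%:Z) && (0 < d i))
  (fun i => 1 <= i <= m%:Z /\ 0 < d i) 1.
- by move=> x; apply: andP.
- by move=> x [/andP[]].
- by exists p.
have [|||i3 i3P] := @is_min_exists (fun i => (1 <= i <= m%:Z) && (d i < 0))
  (fun i => 1 <= i <= m%:Z /\ d i < 0) 1.
- by move=> x; apply: andP.
- by move=> x [/andP[]].
- by exists q.
have [|||i2 i2P] := @is_min_exists
  (fun i => [&& (1 <= i <= m%:Z), (0 < d i) & d (i + 1) <= 0])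
  (fun i => [/\ 1 <= i <= m%:Z, 0 < d i & d (i + 1) <= 0]) 1.
- by move=> x; apply: and3P.
- by move=> x [/andP[]].
(* The last index with d > 0 qualifies: the next d is not positive, either by maximality or because
   d vanishes beyond [m]. *)
- have [|||x [[xm dx] xmax]] := @is_max_exists
    (fun i => (1 <= i <= m%:Z) && (0 < d i))
    (fun i => 1 <= i <= m%:Z /\ 0 < d i) m%:Z.
  + by move=> x; apply: andP.
  + by move=> x [/andP[]].
  + by exists p.
  exists x; split=> //; rewrite leNgt; apply/negP => dx1.
  have xm1 : x + 1 <= m%:Z.
    by rewrite leNgt; apply/negP => mx; move: dx1; rewrite /d diff_out.
  by have := xmax (x + 1); suff /[swap] /[apply] :
      1 <= x + 1 <= m%:Z /\ 0 < d (x + 1); lia.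
have [|||i4 i4P] := @is_min_exists
  (fun i => [&& (1 <= i <= m%:Z), (d i < 0) & 0 <= d (i + 1)])
  (fun i => [/\ 1 <= i <= m%:Z, d i < 0 & 0 <= d (i + 1)]) 1.
- by move=> x; apply: and3P.
- by move=> x [/andP[]].
- have [|||x [[xm dx] xmax]] := @is_max_exists
    (fun i => (1 <= i <= m%:Z) && (d i < 0))
    (fun i => 1 <= i <= m%:Z /\ d i < 0) m%:Z.
  + by move=> x; apply: andP.
  + by move=> x [/andP[]].
  + by exists q.
  exists x; split=> //; rewrite leNgt; apply/negP => dx1.
  have xm1 : x + 1 <= m%:Z.
    by rewrite leNgt; apply/negP => mx; move: dx1; rewrite /d diff_out.
  by have := xmax (x + 1); suff /[swap] /[apply] :
      1 <= x + 1 <= m%:Z /\ d (x + 1) < 0; lia.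
by exists i1, i2, i3, i4.
Qed.

(** Since D is nonnegative, the first nonzero value of d is positive, so $R^+$ starts before $R^-$;
    as d > 0 throughout $R^+$, it also ends before $R^-$. *)
Lemma extremes_signs (m : nat) (C : int -> int) (st : state)
    (i1 i2 i3 i4 : int) :
  dominates m (diff m C st) -> extremes m C st i1 i2 i3 i4 ->
  let d := diff m C st in
  [/\ [/\ 1 <= i1 <= i2, i2 < i3 <= i4 & i4 <= m%:Z],
      forall i : int, i1 <= i <= i2 -> 0 < d i,
      forall i : int, i3 <= i <= i4 -> d i < 0,
      (forall i : int, 1 <= i < i3 -> 0 <= d i) /\ (forall i : int, 1 <= i < i1 -> d i = 0)
    & d (i2 + 1) <= 0 /\ 0 <= d (i4 + 1)].
Proof.
move=> [D [D0 Dm DS D_ge0]].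
case=> [[[i1m d1] i1min] [[i2m d2 d2'] i2min]
        [[i3m d3] i3min] [[i4m d4 d4'] i4min]] d.
rewrite -/d in DS d1 i1min d2 d2' i2min d3 i3min d4 d4' i4min *.
have le12 : i1 <= i2 by apply: i1min.
have le34 : i3 <= i4 by apply: i3min.
have before3 i : 1 <= i < i3 -> 0 <= d i.
  move=> ii; rewrite leNgt; apply/negP => di; have := i3min i; lia.
have before1 i : 1 <= i < i1 -> d i <= 0.
  move=> ii; rewrite leNgt; apply/negP => di; have := i1min i; lia.
(* If [i3 <= i1], then d is nonpositive before [i3], so [D (i3 - 1) <= 0] and [D i3 < 0]. *)
have lt13 : i1 < i3.
  rewrite ltNge; apply/negP => le31.
  have /= := @le_psum (fun i => - D i) (fun i => - d i) 0 (i3 - 1).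
  rewrite D0 => /(_ _ _ (i3 - 1)) D_le0.
  have : - 0 <= - D (i3 - 1).
    apply: D_le0; last by lia.
    - by move=> i ii /=; rewrite (DS i) ?opprD //; lia.
    - by move=> i ii /=; have := before1 i; lia.
  by have := DS i3 i3m; have := D_ge0 i3; lia.
have pos i : i1 <= i <= i2 -> 0 < d i.
  move: i; apply: int_ind_up => // i ii di; rewrite ltNge; apply/negP => di1.
  by have := i2min i; suff /[swap] /[apply] :
      [/\ 1 <= i <= m%:Z, 0 < d i & d (i + 1) <= 0]; [lia | split=> //; lia].
have neg i : i3 <= i <= i4 -> d i < 0.
  move: i; apply: int_ind_up => // i ii di; rewrite ltNge; apply/negP => di1.
  by have := i4min i; suff /[swap] /[apply] :
      [/\ 1 <= i <= m%:Z, d i < 0 & 0 <= d (i + 1)]; [lia | split=> //; lia].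
have lt23 : i2 < i3.
  by rewrite ltNge; apply/negP => le32; have := pos i3; lia.
split=> //; first by split; lia.
by split=> // i ii; have := before1 i ii; have := before3 i; lia.
Qed.

(** * Invariance under the replacement of rows in one column *)

Lemma card_filter_le_succ (A : {fset int}) (k : int) :
  #|` [fset i in A | i <= k]|%:Z =
    #|` [fset i in A | i <= k - 1]|%:Z + (k \in A)%:Z.
Proof.
rewrite (@card_filterD _ _ _ (fun i => i <= k - 1) (pred1 k)) ?PoszD.
  congr (_ + _%:Z); case: (boolP (k \in A)) => kA.
    rewrite (_ : [fset i in A | pred1 k i] = [fset k]) ?cardfs1 //.
    by apply/fsetP => i; rewrite !inE /= andb_idl // => /eqP ->.
  by rewrite filter_fset_none // => i iA; apply: contraNneq kA => <-.
by move=> i _; rewrite /=; case: eqP => /=; lia.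
Qed.

(** Nonnegativity of the new partial sums is checked on three ranges: below [i3] they grow from 0,
    from [i4] on they equal the old ones, and in between they decrease towards the value at [i4].
    Integrality matters: d is at least 1 on [S] and at most -1 on [T], so a change by 1 cannot
    reverse a sign. *)
Lemma dominates_move (m : nat) (d d' : int -> int) (i3 i4 : int)
    (S T : {fset int}) :
  dominates m d -> 1 <= i3 -> i4 <= m%:Z ->
  (forall i : int, 1 <= i < i3 -> 0 <= d i) ->
  (forall i : int, i3 <= i <= i4 -> d i < 0) ->
  (forall i : int, i \in S -> 1 <= i < i3 /\ 0 < d i) ->
  (forall i : int, i \in T -> i3 <= i <= i4) ->
  #|` S| = #|` T| ->
  (forall i : int, 1 <= i <= m%:Z -> d' i = d i - (i \in S)%:Z + (i \in T)%:Z) ->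
  dominates m d'.
Proof.
move=> [D [D0 Dm DS D_ge0]] i3_ge1 i4m d_ge0 d_lt0 Sd Td ST d'E.
pose cnt (A : {fset int}) (k : int) := #|` [fset i in A | i <= k]|%:Z.
have cnt_none (A : {fset int}) k : (forall i : int, i \in A -> k < i) -> cnt A k = 0.
  by move=> Ak; rewrite /cnt filter_fset_none // => i /Ak; rewrite -ltNge.
have cnt_all (A : {fset int}) k : (forall i : int, i \in A -> i <= k) -> cnt A k = #|` A|%:Z.
  by move=> Ak; rewrite /cnt filter_fset_all.
have cntS (A : {fset int}) k : cnt A k = cnt A (k - 1) + (k \in A)%:Z.
  exact: card_filter_le_succ.
pose D' (k : int) := D k - cnt S k + cnt T k.
have D'0 : D' 0 = 0.
  rewrite /D' D0 !cnt_none ?subrr // => i; first by move/Td; lia.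
  by case/Sd; lia.
(* From [i4] on, both counts are complete and cancel. If [i4 < i3], then [T] is empty, hence so is
   [S]. *)
have D'_high k : i4 <= k -> D' k = D k.
  case: (leP i3 i4) => [i34 ik|i43 _].
    rewrite /D' !cnt_all ?ST ?subrK // => i; first by move/Td; lia.
    by case/Sd; lia.
  have T0 : T = fset0.
    by apply/fsetP => i; rewrite inE; apply/negP => /Td; lia.
  have S0 : S = fset0 by apply/eqP; rewrite -cardfs_eq0 ST T0.
  by rewrite /D' S0 T0 subrK.
have D'S i : 1 <= i <= m%:Z -> D' i = D' (i - 1) + d' i.
  move=> im; rewrite /D' (DS i im) (d'E i im) (cntS S) (cntS T).
  by move: (D _) (d _) (cnt S _) (cnt T _) => *; lia.
exists D'; split=> //; first by rewrite D'_high.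
move=> k km; case: (ltP k i3) => [ki3|i3k].
  rewrite -D'0; apply: (@le_psum D' d' 0 k) => [i ik|i ik|]; last by lia.
    by apply: D'S; lia.
  rewrite d'E; last by lia.
  have := d_ge0 i; case: (boolP (i \in S)) => [/Sd|_] /=; lia.
case: (leP i4 k) => [i4k|ki4]; first by rewrite D'_high ?D_ge0.
apply: (@le_trans _ _ (D' i4)); first by rewrite D'_high ?D_ge0 //; lia.
rewrite -lerN2; apply: (@le_psum (fun i => - D' i) (fun i => - d' i) k i4).
- by move=> i ik /=; rewrite (D'S i) ?opprD //; lia.
- move=> i ik /=; rewrite d'E; last by lia.
  have := d_lt0 i; case: (boolP (i \in T)) => /=; lia.
by lia.
Qed.

(** At [i = m] the field [rsum_decr] says that $r_m \ge 0$, since $r_{m+1} = 0$. The field [diff1]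
    makes $i_1 > 1$, so that row $i_1 - 1$ exists. The last three fields are the bookkeeping from
    which the sums of $F_2$ are read off at the end. *)
Record state_inv (m n : nat) (R C : int -> int) (st : state) : Prop := StateInv {
  remaining_le : forall j : int, j \in remaining st -> 1 <= j <= n%:Z;
  rsum_decr : forall i : int, 1 <= i <= m%:Z -> rsum m st (i + 1) <= rsum m st i;
  diff_dominates : dominates m (diff m C st);
  diff1 : diff m C st 1 = 0;
  done_in : forall p, p \in done_part st ->
    [/\ 1 <= p.1 <= m%:Z, 1 <= p.2 <= n%:Z & p.2 \notin remaining st];
  done_row : forall i : int, 1 <= i <= m%:Z ->
    row_sum (done_part st) i = R i - current st i;
  done_col : forall j : int, 1 <= j <= n%:Z -> j \notin remaining st ->
    col_sum (done_part st) j = C j }.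

(** Common core of both steps: an A-step has $S = \{i_1, \ldots, c_j\}$ and $T = I$, a B-step has $S
    = I$ and $T = \{c_j + 1, \ldots, i_4\}$. *)
Lemma fix_column_inv (m n : nat) (R C : int -> int) (st : state)
    (i1 i2 i3 i4 j : int) (K S T : {fset int}) :
  state_inv m n R C st -> 0 <= C j <= m%:Z ->
  extremes m C st i1 i2 i3 i4 -> j \in remaining st ->
  (forall i : int, i \in S -> i1 <= i <= i2 /\ i <= C j) ->
  (forall i : int, i \in T -> i3 <= i <= i4 /\ C j < i) ->
  #|` S| = #|` T| ->
  (forall i : int, (i \in K) = (1 <= i <= C j) && (i \notin S) || (i \in T)) ->
  (forall i : int, i \in K -> i + 1 \notin K -> rsum m st (i + 1) < rsum m st i) ->
  state_inv m n R C (fix_column st j K).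
Proof.
move=> inv Cjm ext jJ Sd Td ST KE Kdrop.
have [[i12 i234 i4m] pos neg [nonneg _] _] :=
  extremes_signs (diff_dominates inv) ext.
have Km i : i \in K -> 1 <= i <= m%:Z.
  by rewrite KE => /orP[/andP[ii _]|/Td[]]; lia.
have rE i : rsum m (fix_column st j K) i = rsum m st i - (i \in K)%:Z.
  rewrite /rsum /=; case: (boolP (i \in K)) => [/Km -> //|_].
  by rewrite subr0.
have bE i : bsum C (fix_column st j K) i = bsum C st i - ((i <= C j)%R : nat)%:Z.
  rewrite /bsum /= !card_filter (big_fsetD1 j jJ) /=; lia.
(* Deleting the column lowers b on rows up to [C j] and r on [K]; these losses differ only on [S]
   and [T]. *)
have dE i : 1 <= i <= m%:Z ->
    diff m C (fix_column st j K) i = diff m C st i - (i \in S)%:Z + (i \in T)%:Z.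
  move=> im; rewrite /diff im rE bE KE.
  have := Sd i; have := Td i.
  by case: (i \in S); case: (i \in T); rewrite ?andbT ?andbF ?orbT ?orbF; lia.
have KC : #|` K|%:Z = C j.
  have -> : K = (zint 1 (C j) `\` S) `|` T.
    by apply/fsetP => i; rewrite KE !inE in_zint andbC.
  have SC : S `<=` zint 1 (C j).
    by apply/fsubsetP => i /Sd; rewrite in_zint; lia.
  have := cardfsUI (zint 1 (C j) `\` S) T.
  rewrite [X in (_ + #|` X|)%N](_ : _ = fset0); last first.
    apply/fsetP => i; rewrite !inE in_zint.
    by apply/negP => /andP[/andP[_ ii] /Td]; lia.
  rewrite cardfs0 addn0 cardfsDS // => ->.
  have := fsubset_leq_card SC; have := card_zint 1 (C j).
  case: ifP; lia.
have dis : [disjoint done_part st & column j K].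
  apply/fdisjointP => p /(done_in inv)[_ _ pJ]; rewrite in_column.
  by apply/negP => /andP[_ /eqP pj]; rewrite pj jJ in pJ.
split=> /=.
- by move=> k; rewrite !inE => /andP[_]; apply: remaining_le inv _.
(* Monotonicity could fail only where row [i] loses a point and row [i + 1] does not; there [Kdrop]
   provides a gap of at least 1. *)
- move=> i im; rewrite !rE; have := rsum_decr inv im; have := Kdrop i.
  by case: (i \in K); case: (i + 1 \in K) => //=; lia.
- apply: (dominates_move (diff_dominates inv) _ i4m nonneg neg _ _ ST dE); first by lia.
  + by move=> i /Sd[ii _]; split; [lia | apply: pos].
  + by move=> i /Td[].
- rewrite dE ?(diff1 inv); last by lia.
  have i1_gt1 : 1 < i1.
    rewrite ltNge; apply/negP => i1_le1.
    by have := pos 1; rewrite (diff1 inv); lia.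
  have := Sd 1; have := Td 1.
  by case: (1 \in S); case: (1 \in T) => //=; lia.
- move=> p; rewrite !inE => /orP[/(done_in inv)[-> -> /negbTE ->]|].
    by rewrite andbF.
  rewrite in_column => /andP[/Km -> /eqP ->]; rewrite eqxx.
  by rewrite (remaining_le inv jJ).
- move=> i im; rewrite row_sumU // row_sum_column (done_row inv im).
  by case: (i \in K) => /=; lia.
- move=> k kn; rewrite !inE negb_and negbK col_sumU // col_sum_column.
  case: (eqVneq k j) => [-> _|_ /= kJ]; last by rewrite addr0 (done_col inv).
  rewrite KC [col_sum _ _](_ : _ = 0) ?add0r // /col_sum filter_fset_none //.
  move=> p /(done_in inv)[_ _ pJ]; apply: contraNneq pJ => ->.
  exact: jJ.
Qed.

(** * The row sets chosen by A-steps and B-steps *)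

Lemma decr_le (m : nat) (r : int -> int) :
  (forall i : int, 1 <= i <= m%:Z -> r (i + 1) <= r i) ->
  forall i k : int, 1 <= i <= k -> k <= m%:Z + 1 -> r k <= r i.
Proof.
move=> r_decr i k /andP[i1 ik] km.
suff: forall k, i <= k <= m%:Z + 1 -> r k <= r i by apply; lia.
by apply: int_ind_up => // l lm; apply: le_trans; apply: r_decr; lia.
Qed.

Lemma card_zintU (a b c e : int) :
  b < c -> #|` zint a b `|` zint c e| = (#|` zint a b| + #|` zint c e|)%N.
Proof.
move=> bc; rewrite -cardfsUI [X in (_ + #|` X|)%N](_ : _ = fset0).
  by rewrite cardfs0 addn0.
by apply/fsetP => i; rewrite !inE !in_zint; lia.
Qed.

(** When the first [s] rows of $R^-$ end inside a block of equal row sums, the rows taken from that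
    block are moved to its bottom [t2]. Then [I] is left only at [t2] and at [t1 - 1], just above
    the block, and r drops at both places. *)
Lemma A_rows_spec (m : nat) (r : int -> int) (i3 i4 s : int) (I : {fset int}) :
  (forall i : int, 1 <= i <= m%:Z -> r (i + 1) <= r i) ->
  1 <= i3 <= i4 -> i4 <= m%:Z -> r (i4 + 1) < r i4 ->
  1 <= s -> i3 + s - 1 <= i4 -> A_rows m r i3 s I ->
  [/\ forall i : int, i \in I -> i3 <= i <= i4, #|` I|%:Z = s
    & forall i : int, i \in I -> i + 1 \notin I -> r (i + 1) < r i].
Proof.
move=> r_decr i34 i4m r4 s1 si4; have rle := decr_le r_decr.
rewrite /A_rows; case: ifP => [rs ->|_].
  split=> [i||i]; first by rewrite in_zint; lia.
    by rewrite card_zint; case: ifP; lia.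
  rewrite !in_zint => ii ii'; suff -> : i = i3 + s - 1 by rewrite subrK.
  by lia.
case=> t1 [t2 [t3 [[[t1m rt1] t1min] [t2m rt2 rt2'] t3E ->]]].
(* The strict drop after [i4] prevents the block from extending beyond $R^-$. *)
have t24 : t2 <= i4.
  rewrite leNgt; apply/negP => lt.
  have := rle (i4 + 1) t2; have := rle (i3 + s - 1) i4; lia.
split=> [i||i]; first by rewrite !inE !in_zint; lia.
  by rewrite card_zintU ?PoszD ?card_zint; last lia; do 2![case: ifP]; lia.
rewrite !inE !in_zint => ii ii'.
have [-> | [it1 i3t1]] : i = t2 \/ i = t1 - 1 /\ i3 < t1 by lia.
  by rewrite rt2.
rewrite it1 subrK lt_neqAle (rle (t1 - 1) t1) ?andbT; try lia.
apply/eqP => re; have := t1min (t1 - 1); rewrite -re rt1.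
by suff /[swap] /[apply] :
    i3 <= t1 - 1 <= i3 + s - 1 /\ r (i3 + s - 1) = r (i3 + s - 1); [lia | split=> //; lia].
Qed.

Lemma A_rows_exist (m : nat) (r : int -> int) (i3 i4 s : int) :
  (forall i : int, 1 <= i <= m%:Z -> r (i + 1) <= r i) ->
  1 <= i3 <= i4 -> i4 <= m%:Z -> r (i4 + 1) < r i4 ->
  1 <= s -> i3 + s - 1 <= i4 -> exists I, A_rows m r i3 s I.
Proof.
move=> r_decr i34 i4m r4 s1 si4; have rle := decr_le r_decr.
rewrite /A_rows; case: ltP => rs; first by exists (zint i3 (i3 + s - 1)).
set v := r (i3 + s - 1) in rs *.
have i3s4 : i3 + s - 1 < i4.
  rewrite lt_neqAle si4 andbT; apply/eqP => e; move: rs; rewrite /v e.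
  suff -> : i3 + s = i4 + 1 by lia.
  by lia.
have rsv : r (i3 + s) = v.
  by apply/eqP; rewrite eq_le rs /v rle //; lia.
have [|||t1 t1P] := @is_min_exists
    (fun t => (i3 <= t <= i3 + s - 1) && (r t == v))
    (fun t => i3 <= t <= i3 + s - 1 /\ r t = v) i3.
- by move=> x; apply: (iffP andP) => -[? /eqP].
- by move=> x [/andP[]].
- by exists (i3 + s - 1); split=> //; lia.
have [|||t2 [[t2m rt2] t2max]] := @is_max_exists
    (fun t => (i3 + s <= t <= m%:Z) && (r t == v))
    (fun t => i3 + s <= t <= m%:Z /\ r t = v) m%:Z.
- by move=> x; apply: (iffP andP) => -[? /eqP].
- by move=> x [/andP[]].
- by exists (i3 + s); split=> //; lia.
exists (zint i3 (t1 - 1) `|` zint (t2 + t1 - i3 - s + 1) t2).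
exists t1, t2, (t2 + t1 - i3 - s + 1); split=> //; split=> //.
rewrite ltNge; apply/negP => vr.
have rt2' : r (t2 + 1) = v.
  by apply/eqP; rewrite eq_le vr -{1}rt2 rle //; lia.
(* If [t2 = m], row [m + 1] lies beyond the drop after [i4], so its value is below [v]. *)
case: (leP (t2 + 1) m%:Z) => t2m1; last first.
  have := rle (i4 + 1) (t2 + 1); have := rle (i3 + s - 1) i4.
  by rewrite rt2' -/v; lia.
have := t2max (t2 + 1).
by suff /[swap] /[apply] :
    i3 + s <= t2 + 1 <= m%:Z /\ r (t2 + 1) = v; [lia | split=> //; lia].
Qed.

(** Mirror image of the A-step choice. The rows of [I] are those the column gives up, so the drops
    are needed where [I] is entered: at the top [t2] of the block and just below the part of the
    block that lies in the last [s] rows of $R^+$. *)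
Lemma B_rows_spec (m : nat) (r : int -> int) (i1 i2 s : int) (I : {fset int}) :
  (forall i : int, 1 <= i <= m%:Z -> r (i + 1) <= r i) ->
  1 < i1 -> i2 <= m%:Z -> r i1 < r (i1 - 1) ->
  1 <= s -> i1 <= i2 - s -> B_rows r i2 s I ->
  [/\ forall i : int, i \in I -> i1 <= i <= i2, #|` I|%:Z = s
    & forall i : int, i \notin I -> i + 1 \in I -> r (i + 1) < r i].
Proof.
move=> r_decr i1_gt1 i2m r1 s1 si1; have rle := decr_le r_decr.
rewrite /B_rows; case: ifP => [rs ->|_].
  split=> [i||i]; first by rewrite in_zint; lia.
    by rewrite card_zint; case: ifP; lia.
  by rewrite !in_zint => ii ii'; suff -> : i = i2 - s by []; lia.
case=> t1 [t2 [t3 [[[t1m rt1] t1max] [t2m rt2 rt2'] t3E ->]]].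
have t21 : i1 <= t2.
  rewrite leNgt; apply/negP => lt.
  have := rle t2 (i1 - 1); have := rle i1 (i2 - s + 1); lia.
split=> [i||i]; first by rewrite !inE !in_zint; lia.
  by rewrite card_zintU ?PoszD ?card_zint; last lia; do 2![case: ifP]; lia.
rewrite !inE !in_zint => ii ii'.
have [it2|[-> t1i2]] : i = t2 - 1 \/ i = t1 /\ t1 < i2 by lia.
  by rewrite it2 subrK.
rewrite lt_neqAle (rle t1 (t1 + 1)) ?andbT; try lia.
apply/eqP => re; have := t1max (t1 + 1); rewrite re rt1.
by suff /[swap] /[apply] :
    i2 - s + 1 <= t1 + 1 <= i2 /\ r (i2 - s + 1) = r (i2 - s + 1); [lia | split=> //; lia].
Qed.

Lemma B_rows_exist (m : nat) (r : int -> int) (i1 i2 s : int) :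
  (forall i : int, 1 <= i <= m%:Z -> r (i + 1) <= r i) ->
  1 < i1 -> i2 <= m%:Z -> r i1 < r (i1 - 1) ->
  1 <= s -> i1 <= i2 - s -> exists I, B_rows r i2 s I.
Proof.
move=> r_decr i1_gt1 i2m r1 s1 si1; have rle := decr_le r_decr.
rewrite /B_rows; case: ltP => rs; first by exists (zint (i2 - s + 1) i2).
set v := r (i2 - s + 1) in rs *.
have rsv : r (i2 - s) = v.
  by apply/eqP; rewrite eq_le rs /v rle //; lia.
have [|||t1 t1P] := @is_max_exists
    (fun t => (i2 - s + 1 <= t <= i2) && (r t == v))
    (fun t => i2 - s + 1 <= t <= i2 /\ r t = v) i2.
- by move=> x; apply: (iffP andP) => -[? /eqP].
- by move=> x [/andP[]].
- by exists (i2 - s + 1); split=> //; lia.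
have [|||t2 [[t2m rt2] t2min]] := @is_min_exists
    (fun t => (1 <= t <= i2 - s) && (r t == v))
    (fun t => 1 <= t <= i2 - s /\ r t = v) 1.
- by move=> x; apply: (iffP andP) => -[? /eqP].
- by move=> x [/andP[]].
- by exists (i2 - s); split=> //; lia.
(* The block cannot cross the strict drop before [i1]; since [i1 > 1], this also gives the bound
   [2 <= t2] required by [B_rows]. *)
have t2i1 : i1 <= t2.
  rewrite leNgt; apply/negP => lt.
  have := rle t2 (i1 - 1); have := rle i1 (i2 - s); lia.
exists (zint t2 (t2 + s - 1 - (i2 - t1)) `|` zint (t1 + 1) i2).
exists t1, t2, (t2 + s - 1 - (i2 - t1)); split=> //; split=> //; first by lia.
rewrite lt_neqAle (rle (t2 - 1) t2) ?andbT; try lia.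
rewrite rt2; apply/eqP => re; have := t2min (t2 - 1).
by suff /[swap] /[apply] :
    1 <= t2 - 1 <= i2 - s /\ r (t2 - 1) = v; [lia | split=> //; lia].
Qed.

(** * Preservation of the invariant and existence of the next step *)

Lemma bsum_gt (C : int -> int) (st : state) (i k : int) :
  bsum C st k < bsum C st i -> exists2 j, j \in remaining st & i <= C j < k.
Proof.
rewrite /bsum ltz_nat => lt; apply/hasP/negPn/negP; rewrite -all_predC => /allP H.
move: lt; rewrite ltnNge => /negP; apply; apply: fsubset_leq_card.
apply/fsubsetP => j; rewrite !inE /= => /andP[jJ ij]; rewrite jJ.
by have := H _ jJ; rewrite /= ij -leNgt.
Qed.

Lemma bsum_decr (C : int -> int) (st : state) (i k : int) :
  i <= k -> bsum C st k <= bsum C st i.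
Proof.
move=> ik; rewrite /bsum lez_nat fsubset_leq_card //.
apply/fsubsetP => j; rewrite !inE /= => /andP[-> kj]; exact: le_trans kj.
Qed.

(** At each boundary of $R^+$ and $R^-$ the sign of $d = b - r$ changes. Where d goes up, r must
    drop because b does not increase; where d goes down, b must drop because r does not increase.
    Drops of r confine [I]; drops of b provide a column to treat. *)
Lemma rsum_drops (m n : nat) (R C : int -> int) (st : state) (i1 i2 i3 i4 : int) :
  state_inv m n R C st -> extremes m C st i1 i2 i3 i4 ->
  [/\ 1 < i1, rsum m st i1 < rsum m st (i1 - 1),
      rsum m st (i4 + 1) < rsum m st i4,
      bsum C st (i2 + 1) < bsum C st i2
    & bsum C st i3 < bsum C st (i3 - 1)].
Proof.
move=> inv ext.
have [[i12 i234 i4m] pos neg [nonneg zero] [d2 d4]] :=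
  extremes_signs (diff_dominates inv) ext.
have i1_gt1 : 1 < i1.
  rewrite ltNge; apply/negP => i1_le1.
  by have := pos 1; rewrite (diff1 inv); lia.
have dE i : 1 <= i <= m%:Z -> diff m C st i = bsum C st i - rsum m st i.
  by rewrite /diff => ->.
split=> //.
- have := zero (i1 - 1); have := pos i1; rewrite !dE; try lia.
  by have := @bsum_decr C st (i1 - 1) i1; lia.
- have := neg i4; rewrite dE; last by lia.
  case: (ltP i4 m%:Z) => [i4m'|mi4].
    move: d4; rewrite dE; last by lia.
    by have := @bsum_decr C st i4 (i4 + 1); lia.
  (* Here [i4 = m]: the next row sum is 0 by convention, while $r_m > b_m \ge 0$. *)
  rewrite {2}/rsum ifF; last by lia.
  by have : 0 <= bsum C st i4 by []; lia.
- have := pos i2; move: d2; rewrite !dE; try lia.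
  by have := @rsum_decr _ _ _ _ _ inv i2; lia.
- have := neg i3; have := nonneg (i3 - 1); rewrite !dE; try lia.
  by have := @rsum_decr _ _ _ _ _ inv (i3 - 1); rewrite subrK; lia.
Qed.

Lemma step_inv (m n : nat) (R C : int -> int) (st st' : state) :
  (forall j : int, 1 <= j <= n%:Z -> 0 <= C j <= m%:Z) ->
  state_inv m n R C st -> step m C st st' ->
  state_inv m n R C st' /\ (#|` remaining st'| < #|` remaining st|)%N.
Proof.
move=> Cm inv [_ stst'].
have card_lt j K : j \in remaining st ->
    (#|` remaining (fix_column st j K)| < #|` remaining st|)%N.
  by move=> jJ; rewrite /= (cardfsD1 j (remaining st)) jJ.
have r_decr := rsum_decr inv.
case: stst' => -[i1 [i2 [i3 [i4 [j [s [I [ext [lens [[jJ jI] _] sE Irows ->]]]]]]]]].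
  split; last exact: card_lt.
  have [[i12 i234 i4m] _ _ _ _] := extremes_signs (diff_dominates inv) ext.
  have [i1_gt1 r1 r4 _ _] := rsum_drops inv ext.
  move: jI lens; rewrite in_zint -lez_nat !card_zint !ifT; try lia.
  move=> jI lens.
  (* The comparison of lengths gives $s \le |R^+| \le |R^-|$, so the first [s] rows of $R^-$
     exist. *)
  have [|||||I34 Is Idrop] := A_rows_spec (i4 := i4) r_decr _ _ _ _ _ Irows; try lia.
  apply: (fix_column_inv (S := zint i1 (C j)) (T := I) inv _ ext) => //.
  - exact/Cm/(remaining_le inv).
  - by move=> i; rewrite in_zint; lia.
  - by move=> i /I34; lia.
  - by apply/eqP; rewrite -eqz_nat Is card_zint ifT; lia.
  - by move=> i; rewrite !inE !in_zint; congr orb; lia.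
  move=> i; rewrite !inE !in_zint negb_or => iK /andP[iK' iI'].
  case: (boolP (i \in I)) iK => [iI _|_]; first exact: Idrop.
  rewrite orbF => ii; suff -> : i = i1 - 1 by rewrite subrK.
  by lia.
split; last exact: card_lt.
have [[i12 i234 i4m] _ _ _ _] := extremes_signs (diff_dominates inv) ext.
have [i1_gt1 r1 r4 _ _] := rsum_drops inv ext.
move: jI lens; rewrite in_zint -ltz_nat !card_zint !ifT; try lia.
move=> jI lens.
(* Here $s \le |R^-| < |R^+|$, so row [i2 - s] still belongs to $R^+$. *)
have [|||||I12 Is Idrop] := B_rows_spec (i1 := i1) r_decr _ _ _ _ _ Irows; try lia.
apply: (fix_column_inv (S := I) (T := zint (C j + 1) i4) inv _ ext) => //.
- exact/Cm/(remaining_le inv).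
- by move=> i /I12; lia.
- by move=> i; rewrite in_zint; lia.
- by apply/eqP; rewrite -eqz_nat Is card_zint ifT; lia.
- by move=> i; rewrite !inE !in_zint andbC.
move=> i; rewrite !inE !in_zint.
(* The new column is left either when the next row is in [I], or after its last row [i4]. *)
case: (boolP (i + 1 \in I)) => [iI'|_] iK iK'.
  apply: Idrop => //; move: iK; case: (boolP (i \in I)) => //= /I12.
  by have := I12 _ iI'; lia.
suff -> : i = i4 by [].
by move: iK; case: (i \in I) => /=; lia.
Qed.

Lemma step_exists (m n : nat) (R C : int -> int) (st : state) :
  state_inv m n R C st -> stopped m C st \/ exists st', step m C st st'.
Proof.
move=> inv; have [stp|[i0 i0m di0]] := stoppedP m C st; [by left|right].
have nst : ~ stopped m C st by move=> /(_ i0 i0m) d0; rewrite d0 in di0.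
have [i1 [i2 [i3 [i4 ext]]]] := extremes_exist (diff_dominates inv) i0m di0.
have [[i12 i234 i4m] _ _ _ _] := extremes_signs (diff_dominates inv) ext.
have [i1_gt1 r1 r4 b2 b3] := rsum_drops inv ext.
have r_decr := rsum_decr inv.
have cardz a b : a <= b -> #|` zint a b|%:Z = b - a + 1.
  by rewrite card_zint => ->.
case: (leqP #|` zint i1 i2| #|` zint i3 i4|) => lens.
  (* The drop of b after [i2] yields a remaining column of height exactly [i2], which lies in
     $R^+$. *)
  have [j0 j0J Cj0] := bsum_gt b2.
  have [|||j jP] := @is_max_exists
      (fun k => (k \in remaining st) && (C k \in zint i1 i2))
      (fun k => k \in remaining st /\ C k \in zint i1 i2) n%:Z.
  - by move=> x; apply: andP.
  - by move=> x [/(remaining_le inv)/andP[]].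
  - by exists j0; split=> //; rewrite in_zint; lia.
  have jI := jP.1.2; rewrite in_zint in jI.
  have := lens; rewrite -lez_nat !cardz; try lia; move=> lens'.
  have [|||||I IP] := @A_rows_exist m (rsum m st) i3 i4 (C j - i1 + 1) r_decr; try lia.
  eexists; split=> //; left.
  by exists i1, i2, i3, i4, j, (C j - i1 + 1), I; split=> //; split=> //; exact: jP.
(* The drop of b before [i3] yields a remaining column of height exactly [i3 - 1], as a B-step
   requires. *)
have [j0 j0J Cj0] := bsum_gt b3.
have [|||j jP] := @is_min_exists
    (fun k => (k \in remaining st) && (C k + 1 \in zint i3 i4))
    (fun k => k \in remaining st /\ C k + 1 \in zint i3 i4) 1.
- by move=> x; apply: andP.
- by move=> x [/(remaining_le inv)/andP[]].
- by exists j0; split=> //; rewrite in_zint; lia.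
have jI := jP.1.2; rewrite in_zint in jI.
have := lens; rewrite -ltz_nat !cardz; try lia; move=> lens'.
have [|||||I IP] := @B_rows_exist m (rsum m st) i1 i2 (i4 - C j) r_decr; try lia.
eexists; split=> //; right.
by exists i1, i2, i3, i4, j, (i4 - C j), I; split=> //; split=> //; exact: jP.
Qed.

(** * The initial state, the stopped states and termination *)

Lemma col_sum_bounds (m n : nat) (R C : int -> int) (F : {fset int * int}) (j : int) :
  has_sums m n R C F -> 1 <= j <= n%:Z -> 0 <= C j <= m%:Z.
Proof.
move=> [Fmn _ FC] jn; rewrite -FC // /col_sum /=.
suff : [fset p in F | p.2 == j] `<=` column j (zint 1 m%:Z).
  move=> /fsubset_leq_card; rewrite card_column.
  by rewrite -lez_nat card_zint; case: ifP => _ le; rewrite (le_trans le) //; lia.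
apply/fsubsetP => p; rewrite !inE in_column in_zint /= => /andP[/Fmn[-> _] ->].
by [].
Qed.

Lemma card_rows_le (F : {fset int * int}) (k : int) :
  #|` [fset p in F | p.1 <= k]|%:Z =
    #|` [fset p in F | p.1 <= k - 1]|%:Z + row_sum F k.
Proof.
rewrite /row_sum -PoszD; congr Posz; apply: card_filterD => -[i j] _ /=.
by case: eqP => /=; lia.
Qed.

(** This is where consistency enters: any realisation [F] has at most $\min(c_j, k)$ points in the
    first [k] rows of column [j], and $F_1$ attains this bound. *)
Lemma init_inv (m n : nat) (R C : int -> int) :
  (0 < m)%N -> R 1 = n%:Z ->
  (forall i : int, 1 <= i < m%:Z -> R (i + 1) <= R i) ->
  consistent m n R C -> state_inv m n R C (init n R).
Proof.
move=> m_gt0 R1 R_decr [F FS]; have [Fmn FR FC] := FS.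
have Cm j := @col_sum_bounds m n R C F j FS.
set N := neighbour C (zint 1 n%:Z).
have NJ p : p \in N -> p.2 \in zint 1 n%:Z by rewrite in_neighbour => /andP[].
have FJ p : p \in F -> p.2 \in zint 1 n%:Z by move=> /Fmn[_]; rewrite in_zint.
have NR (i : int) : 1 <= i -> row_sum N i = bsum C (init n R) i.
  exact: row_sum_neighbour.
have dom : dominates m (diff m C (init n R)).
  (* D k is the surplus of $F_1$ over [F] in the first [k] rows; it vanishes at [m] because the two
     sets have the same column sums. *)
  exists (fun k => #|` [fset p in N | p.1 <= k]|%:Z - #|` [fset p in F | p.1 <= k]|%:Z).
  split.
  - rewrite (@filter_fset_none _ N) => [|p]; last first.
      by rewrite in_neighbour -ltNge => /andP[_ /andP[]].
    rewrite (@filter_fset_none _ F) ?subrr // => p /Fmn[/andP[p1 _] _].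
    by rewrite -ltNge.
  - rewrite (@filter_fset_all _ N) => [|[i j]]; last first.
      by rewrite in_neighbour in_zint /= => /andP[/Cm]; lia.
    rewrite (@filter_fset_all _ F) => [|p /Fmn]; last by lia.
    apply/eqP; rewrite subr_eq0 eqz_nat (card_by_column NJ) (card_by_column FJ).
    apply/eqP; rewrite big_seq [RHS]big_seq; apply: eq_bigr => j jn.
    apply/eqP; rewrite -eqz_nat; have := col_sum_neighbour C (zint 1 n%:Z) j.
    rewrite jn /col_sum -/N => ->; move: jn; rewrite in_zint => jn.
    have := FC j jn; rewrite /col_sum => ->; rewrite card_zint.
    by have := Cm j jn; case: ifP; lia.
  - move=> i im; rewrite card_rows_le (card_rows_le F) NR ?FR //; last by lia.
    by rewrite /diff /rsum im /=; lia.
  move=> k km; rewrite subr_ge0 lez_nat.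
  rewrite (@card_by_column [fset p in N | p.1 <= k] (zint 1 n%:Z)); last first.
    by move=> p; rewrite !inE => /andP[/NJ].
  rewrite (@card_by_column [fset p in F | p.1 <= k] (zint 1 n%:Z)); last first.
    by move=> p; rewrite !inE => /andP[/FJ].
  rewrite big_seq [leqRHS]big_seq; apply: leq_sum => j jn.
  rewrite (card_col_neighbour C k jn) minElt; move: jn; rewrite in_zint => jn.
  case: ltP => [_|kC].
    rewrite -lez_nat card_zint; have := FC j jn; have := Cm j jn.
    suff : (#|` [fset p in [fset p in F | (p.1 <= k)%R] | p.2 == j]| <=
        #|` [fset p in F | p.2 == j]|)%N.
      by rewrite /col_sum; case: ifP; lia.
    apply: fsubset_leq_card; apply/fsubsetP => p; rewrite !inE /=.
    by case/andP => /andP[-> _] ->.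
  rewrite -(card_column j).
  apply: fsubset_leq_card; apply/fsubsetP => p; rewrite !inE in_column in_zint /=.
  by case/andP => /andP[/Fmn[/andP[-> _] _] ->] ->.
split=> //=.
- by move=> j; rewrite in_zint.
- move=> i im; rewrite /rsum im /=; case: ifP => im1; first by apply: R_decr; lia.
  (* For [i = m] the claim is that [R m] is nonnegative, which holds because it is a row sum of
     [F]. *)
  by rewrite -FR.
- case: (dom) => D [D0 _ DS D_ge0].
  have d1E := DS 1; rewrite subrr D0 add0r in d1E.
  have d1_ge0 := D_ge0 1; rewrite d1E in d1_ge0; try lia.
  (* Row 1 of $F_1$ has at most $n = r_1$ points; the opposite inequality is [D 1 >= 0]. *)
  have d1_le0 : diff m C (init n R) 1 <= 0.
    rewrite /diff; case: ifP => // m1; rewrite /rsum m1 /= R1 subr_le0 /bsum /=.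
    have : [fset j in zint 1 n%:Z | 1 <= C j] `<=` zint 1 n%:Z.
      by apply/fsubsetP => j; rewrite !inE => /andP[].
    move/fsubset_leq_card; rewrite -lez_nat card_zint => /le_trans; apply.
    by case: ifP; lia.
  by apply/eqP; rewrite eq_le d1_le0 d1_ge0 //; lia.
- by move=> i _; rewrite subrr /row_sum filter_fset_none.
- by move=> j jn; rewrite in_zint jn.
Qed.

(** When d = 0, the untreated columns of $F_1$ contribute exactly the current row sums, which are
    what the treated columns leave of [R]. *)
Lemma stopped_has_sums (m n : nat) (R C : int -> int) (st : state) :
  (forall j : int, 1 <= j <= n%:Z -> 0 <= C j <= m%:Z) ->
  state_inv m n R C st -> stopped m C st -> has_sums m n R C (F2 C st).
Proof.
move=> Cm inv stp.
have dis : [disjoint done_part st & neighbour C (remaining st)].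
  apply/fdisjointP => p /(done_in inv)[_ _ pJ].
  by rewrite in_neighbour (negbTE pJ).
split=> [p|i im|j jn].
- rewrite !inE => /orP[/(done_in inv)[]//|]; rewrite in_neighbour.
  move=> /andP[/(remaining_le inv) pn /andP[p1 pC]].
  by have /andP[_ Cpm] := Cm _ pn; rewrite p1 (le_trans pC Cpm).
- rewrite row_sumU // row_sum_neighbour; last by lia.
  rewrite (done_row inv im).
  have := stp i im; rewrite /diff /rsum im /bsum => /eqP.
  by rewrite subr_eq0 => /eqP ->; rewrite subrK.
rewrite col_sumU // col_sum_neighbour; case: ifP => [jJ|/negbT jJ].
  rewrite [col_sum _ _](_ : _ = 0) ?add0r /col_sum; last first.
    rewrite filter_fset_none // => p /(done_in inv)[_ _ pJ].
    by apply: contraNneq pJ => ->.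
  by rewrite card_zint; have := Cm j jn; case: ifP; lia.
by rewrite addr0 (done_col inv).
Qed.

Theorem theorem1 (m n : nat) (R C : int -> int)
    (m_gt0 : (0 < m)%N) (n_gt0 : (0 < n)%N)
    (R1 : R 1 = n%:Z)
    (R_decr : forall i : int, 1 <= i < m%:Z -> R (i + 1) <= R i)
    (C1 : C 1 = m%:Z)
    (C_decr : forall j : int, 1 <= j < n%:Z -> C (j + 1) <= C j)
    (RC_consistent : consistent m n R C) :
  (* the procedure never gets stuck before it stops *)
  (forall st : state, reachable m n R C st ->
     stopped m C st \/ exists st' : state, step m C st st') /\
  (* no run is infinite *)
  ~ (exists f : nat -> state,
       f 0%N = init n R /\ forall k : nat, step m C (f k) (f k.+1)) /\
  (* hence some run stops, and every run that stops yields the required sums *)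
  (exists st : state, reachable m n R C st /\ stopped m C st) /\
  (forall st : state, reachable m n R C st -> stopped m C st ->
     has_sums m n R C (F2 C st)).
Proof.
have [F FS] := RC_consistent.
have Cm j := @col_sum_bounds m n R C F j FS.
have inv0 : state_inv m n R C (init n R) by exact: init_inv.
have reach_inv st : reachable m n R C st -> state_inv m n R C st.
  move=> /clos_rt_rtn1_iff; elim=> // st1 st2 st12 _ inv1.
  by have [] := step_inv Cm inv1 st12.
split; first by move=> st /reach_inv; apply: step_exists.
split.
  case=> f [f0 fS].
  (* Each step removes a column, so taking [k] one larger than the initial number of columns gives a
     contradiction. *)
  have fP k : state_inv m n R C (f k) /\
      (#|` remaining (f k)| + k <= #|` remaining (f 0%N)|)%N.
    elim: k => [|k [invk lek]]; first by rewrite f0 addn0.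
    have [invS ltS] := step_inv Cm invk (fS k); split=> //; lia.
  by have [_] := fP (#|` remaining (f 0%N)|).+1; lia.
split; last by move=> st /reach_inv; apply: stopped_has_sums.
(* Induction on a strict bound for the number of remaining columns, generalised to every reachable
   state. *)
have [k] := ubnP #|` remaining (init n R)|.
have : reachable m n R C (init n R) by apply: rt_refl.
elim: k (init n R) => // k IH st reach_st ltk.
have inv := reach_inv st reach_st.
have [stp|[st' st'P]] := step_exists inv; first by exists st.
apply: (IH st'); first exact: rt_trans reach_st (rt_step _ _ _ _ st'P).
by have [_] := step_inv Cm inv st'P; lia.
Qed.
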